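(* Let $0<\lambda<1$ and let $p,q\in[1,\infty]$ satisfy (i) $\frac1q<\frac1p-\frac12(1-\lambda)$, and (ii) $\frac1q<\lambda$ and $\frac1p>1-\lambda$. Then the operator $T^\lambda$, defined on finitely supported functions $f:\mathbb{Z}^3\to\mathbb{C}$ by $$T^\lambda f(n,t)=\sum_{m\in\mathbb{Z}^2,\ m\neq 0}\frac{f(n-m,\,t-\omega(n,m))}{|m|^{2\lambda}},\qquad (n,t)\in\mathbb{Z}^2\times\mathbb{Z},$$ extends to a bounded operator from $\ell^p(\mathbb{Z}^3)$ to $\ell^q(\mathbb{Z}^3)$; that is, there is a constant $A$ (independent of $f$) such that $$\|T^\lambda f\|_{\ell^q(\mathbb{Z}^3)}\le A\,\|f\|_{\ell^p(\mathbb{Z}^3)}.$$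
   Context: $\mathbb{Z}^3$ is identified with $\mathbb{Z}^2\times\mathbb{Z}$. For $n=(n_1,n_2)$ and $m=(m_1,m_2)$ in $\mathbb{Z}\times\mathbb{Z}$, $\omega(n,m)=2(n_2m_1-n_1m_2)$ is the symplectic bilinear form, and $|m|$ denotes the Euclidean norm of $m$. The convention $1/\infty=0$ is used. *)

(* Defs.v *)
From HB Require Import structures.
From mathcomp Require Import all_boot all_order all_algebra.
From mathcomp Require Import all_classical all_reals all_analysis.
From mathcomp Require Import complex.

Set Implicit Arguments.
Unset Strict Implicit.
Unset Printing Implicit Defensive.
Import Order.TTheory GRing.Theory Num.Theory.

Local Open Scope classical_set_scope.
Local Open Scope ring_scope.
Local Open Scope complex_scope.

(* An alias, so that it carries the discrete sigma-algebra rather than a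
   product one: every function on it is measurable. *)
Definition Z3 : Type := ((int * int) * int)%type.
HB.instance Definition _ := Choice.on Z3.
HB.instance Definition _ := isPointed.Build Z3 ((0, 0), 0).
HB.instance Definition _ := @isMeasurable.Build default_measure_display
  Z3 discrete_measurable discrete_measurable0
  discrete_measurableC discrete_measurableU.

Definition omega (n m : int * int) : int := 2 * (n.2 * m.1 - n.1 * m.2).

Definition enorm (R : realType) (m : int * int) : R :=
  Num.sqrt (m.1%:~R ^+ 2 + m.2%:~R ^+ 2).

Definition finitely_supported (R : realType) (f : Z3 -> R[i]) : Prop :=
  finite_set [set x | f x != 0].

Definition lpnorm (R : realType) (p : \bar R) (f : Z3 -> R[i]) : \bar R :=
  Lnorm (@counting Z3 R) p (fun x => (Normc.normc (f x))%:E).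

(* [\sum_(m \in _)] ranges over the support of the summand, which is finite
   when [f] is finitely supported, see [finite_support_Tlam] *)
Definition Tlam (R : realType) (lam : R) (f : Z3 -> R[i]) : Z3 -> R[i] :=
  fun x => \sum_(m \in [set m : int * int | m != 0])
    f (x.1 - m, x.2 - omega x.1 m) / (enorm R m `^ (2 * lam))%:C.

Lemma finite_support_Tlam (R : realType) (lam : R) (f : Z3 -> R[i]) (x : Z3) :
  finitely_supported f ->
  finite_set ([set m : int * int | m != 0] `&`
    (fun m => f (x.1 - m, x.2 - omega x.1 m)
              / (enorm R m `^ (2 * lam))%:C) @^-1` [set~ 0]).
Proof.
move=> fin_f; apply: (@sub_finite_set _ _
  ((fun y : Z3 => x.1 - y.1) @` [set y | f y != 0])).
- move=> m [_ /= /eqP fm]; exists (x.1 - m, x.2 - omega x.1 m) => /=.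
    by apply: contra fm => /eqP ->; rewrite mul0r.
  by rewrite subKr.
- exact: finite_image.
Qed.

(* Main.v *)
Require Import Defs.
From mathcomp Require Import all_boot all_order all_algebra.
From mathcomp Require Import all_classical all_reals all_analysis.
From mathcomp Require Import ess_sup_inf complex.
From mathcomp Require Import zify ring lra.
Import Order.TTheory GRing.Theory Num.Theory.
Local Open Scope ring_scope.

(** The operator is dominated by dyadic averages over boxes,
      T f <= C sum_j 2^(-2 lam j) A_(2^j) |f|,
    where A_N f (x) sums f over the points x m = (x.1 - m, x.2 - omega x.1 m)
    with |m| <= N in the sup norm.  It therefore suffices to bound a single
    A_N from l^p to l^q by N^(2 lam'), up to a power of log N, for some
    lam' < lam.

    The estimate that carries the theorem is
      || A_N f ||_3 <= C N^(2/3) (log N)^(1/3) || f ||_(3/2)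
    (sum_avg_cube_le).  It is sharp up to the logarithm, both for a point mass
    and for a segment of a horizontal line.  All other exponents come from
    interpolating it with the trivial bounds l^1 -> l^oo (norm 1) and
    l^1 -> l^1, l^oo -> l^oo (norm at most 9 N^2), and from the inclusions of
    the l^p spaces.  The three conditions on p and q say exactly that
    (1/p, 1/q) can be reached in this way with some lam' < lam
    (exponents_exist).  Since A_N has a nonnegative kernel, interpolation is
    just Hoelder's inequality (sum_avg_powR_le).

    For the (3/2, 3) bound, expand the cube of A_N f at x as a sum over triples
    of neighbours y1, y2, y3 of x.  Put d = y1.1 - y2.1 and
    rho (d) = gcd (d) / |d|, with rho (0) = N.  Two facts are used.
    - The common neighbours of y1 and y2 lie on a line with primitive
      direction d / gcd (d), so there are at most 9 N rho (d) of them
      (common_neighbours_le).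
    - The sum of rho (i - k) over k in the box of radius N is O(N log N), for
      every i in the box (sum_rho).
    So pairs with many common neighbours are correspondingly rare.
    With f = h^2, the product (h1 h2 h3)^2 is at most the sum of
    rho_13 / rho_12 (h1 h2)^3 and its five permutations, because the product of
    these six terms is (h1 h2 h3)^12.  In each term, summing over the index
    missing from (h1 h2)^3 costs O(N log N), and the number of x then left
    for each pair is O(N rho_12), which the weight 1 / rho_12 cancels; what
    remains is O(N^2 log N) (sum h^3)^2.

    Every estimate is proved for sums over finite sequences X of distinct
    points of Z3, uniformly in X.  The integral against the counting measure
    appears only at the end. *)

Set Implicit Arguments.
Unset Strict Implicit.
Unset Printing Implicit Defensive.

(** * Finite sums and Hoelder's inequality *)

Section FiniteSums.
Context {R : realType}.
Implicit Types (T U : eqType).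

Lemma ler_sum_inj T U (s : seq T) (t : seq U) (h : T -> U) (F : T -> R)
    (G : U -> R) :
  uniq s -> {in s &, injective h} -> {in s, forall x, h x \in t} ->
  {in s, forall x, F x <= G (h x)} -> (forall u, 0 <= G u) ->
  \sum_(x <- s) F x <= \sum_(u <- t) G u.
Proof.
move=> us hi hst FG G0.
apply: (@le_trans _ _ (\sum_(u <- map h s) G u)).
  by rewrite big_map [leLHS]big_seq [leRHS]big_seq; apply: ler_sum.
have um : uniq (map h s) by rewrite map_inj_in_uniq.
rewrite -(undup_id um).
have : {subset undup (map h s) <= t}.
  by move=> u; rewrite mem_undup => /mapP[x xs ->]; exact: hst.
move: (undup_uniq (map h s)); elim: (undup _) t {hst} => [|u r IH] t.
  by move=> _ _; rewrite big_nil sumr_ge0.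
move=> /= /andP[ur Ur] rt; rewrite big_cons.
have ut : u \in t by apply: rt; rewrite mem_head.
rewrite (perm_big _ (perm_to_rem ut)) /= big_cons lerD2l; apply: IH => // v vr.
have vt : v \in t by apply: rt; rewrite in_cons vr orbT.
move: vt; rewrite (perm_mem (perm_to_rem ut)) in_cons => /orP[/eqP vu|//].
by rewrite -vu vr in ur.
Qed.

Lemma ler_sum_subset T (s t : seq T) (F : T -> R) :
  uniq s -> {subset s <= t} -> (forall x, 0 <= F x) ->
  \sum_(x <- s) F x <= \sum_(x <- t) F x.
Proof. by move=> us st F0; apply: (@ler_sum_inj _ _ s t id). Qed.

(** Double counting: the sum over [s] is organised by the fibres of [h]. *)
Lemma ler_sum_fibre T U (s : seq T) (h : T -> U) (F : T -> R) (G : U -> R)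
    (K : R) (t : seq U) :
  uniq t -> {in s, forall x, h x \in t} ->
  (forall u, \sum_(x <- s | h x == u) F x <= K * G u) ->
  \sum_(x <- s) F x <= K * \sum_(u <- t) G u.
Proof.
move=> ut hst FG.
rewrite (eq_big_seq (fun x => \sum_(u <- t) if h x == u then F x else 0)).
  rewrite exchange_big /= mulr_sumr; apply: ler_sum => u _.
  by rewrite -big_mkcond.
move=> x xs; rewrite (bigD1_seq (h x)) ?hst //= eqxx.
by rewrite big1 ?addr0 // => u; rewrite eq_sym => /negPf ->.
Qed.

Lemma size_inj_leq T (s : seq T) (h : T -> nat) (k : nat) :
  uniq s -> {in s &, injective h} -> {in s, forall x, (h x < k)%N} ->
  (size s <= k)%N.
Proof.
move=> us hi hk; rewrite -(size_iota 0 k) -(size_map h).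
apply: uniq_leq_size; first by rewrite map_inj_in_uniq.
by move=> u /mapP[x xs ->]; rewrite mem_iota /= hk.
Qed.

Lemma sum_cube T (s : seq T) (F : T -> R) :
  (\sum_(i <- s) F i) ^+ 3 =
  \sum_(i <- s) \sum_(j <- s) \sum_(k <- s) F i * F j * F k.
Proof.
rewrite !exprS expr0 mulr1 mulr_suml; apply: eq_bigr => i _.
rewrite mulr_suml mulr_sumr; apply: eq_bigr => j _.
by rewrite !mulr_sumr; apply: eq_bigr => k _; rewrite mulrA.
Qed.

End FiniteSums.

Section Hoelder.
Context {R : realType}.

Lemma powR_AGM (a b t : R) : 0 <= a -> 0 <= b -> 0 <= t <= 1 ->
  a `^ t * b `^ (1 - t) <= t * a + (1 - t) * b.
Proof.
move=> a0 b0 /andP[]; rewrite le_eqVlt => /orP[/eqP <- _|t0].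
  by rewrite powRr0 subr0 powRr1 // !mul1r mul0r add0r.
rewrite le_eqVlt => /orP[/eqP ->|t1].
  by rewrite subrr powRr0 powRr1 // mulr1 mul1r mul0r addr0.
have := @conjugate_powR R (a `^ t) (b `^ (1 - t)) t^-1 (1 - t)^-1.
rewrite !invrK !powR_ge0 !invr_gt0 subr_gt0 -!powRrM.
rewrite !divff ?lt0r_neq0 ?subr_gt0 // !powRr1 // [a * t]mulrC [b * _]mulrC.
by apply=> //; rewrite addrC subrK.
Qed.

Lemma hoelder_seq (I : eqType) (r : seq I) (a b : I -> R) (t : R) :
  (forall i, 0 <= a i) -> (forall i, 0 <= b i) -> 0 <= t <= 1 ->
  \sum_(i <- r) a i `^ t * b i `^ (1 - t)
    <= (\sum_(i <- r) a i) `^ t * (\sum_(i <- r) b i) `^ (1 - t).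
Proof.
move=> a0 b0 /andP[]; rewrite le_eqVlt => /orP[/eqP <- _|t0].
  rewrite powRr0 subr0 mul1r powRr1 ?sumr_ge0 //.
  by apply: ler_sum => i _; rewrite powRr0 mul1r powRr1.
rewrite le_eqVlt => /orP[/eqP ->|t1].
  rewrite subrr powRr0 mulr1 powRr1 ?sumr_ge0 //.
  by apply: ler_sum => i _; rewrite powRr0 mulr1 powRr1.
have tN0 : t != 0 by rewrite gt_eqF.
have t'N0 : 1 - t != 0 by rewrite gt_eqF // subr_gt0.
set A := \sum_(i <- r) a i; set B := \sum_(i <- r) b i.
have vanish (c : I -> R) (p : R) : (forall i, 0 <= c i) -> p != 0 ->
    \sum_(i <- r) c i = 0 -> {in r, forall i, c i `^ p = 0}.
  move=> c0 pN0 /eqP; rewrite psumr_eq0 => [/allP cr i /cr /= /eqP ->|i _].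
    by rewrite powR0.
  exact: c0.
have AB0 : 0 <= A `^ t * B `^ (1 - t) by rewrite mulr_ge0 ?powR_ge0.
have [A0|AN0] := eqVneq A 0.
  by rewrite big_seq big1 // => i ir; rewrite (vanish a t) ?mul0r.
have [B0|BN0] := eqVneq B 0.
  by rewrite big_seq big1 // => i ir; rewrite (vanish b (1 - t)) ?mulr0.
have Agt0 : 0 < A by rewrite lt_neqAle eq_sym AN0 sumr_ge0.
have Bgt0 : 0 < B by rewrite lt_neqAle eq_sym BN0 sumr_ge0.
have -> : A `^ t * B `^ (1 - t) =
    \sum_(i <- r) A `^ t * B `^ (1 - t) * (t * (a i / A) + (1 - t) * (b i / B)).
  rewrite -mulr_sumr big_split /= -!mulr_sumr -!mulr_suml -/A -/B !divff //.
  by rewrite !mulr1 addrC subrK mulr1.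
apply: ler_sum => i _.
have aA : 0 <= a i / A by rewrite divr_ge0 // ltW.
have bB : 0 <= b i / B by rewrite divr_ge0 // ltW.
have -> : a i `^ t = (a i / A) `^ t * A `^ t.
  by rewrite -powRM ?divfK // ltW.
have -> : b i `^ (1 - t) = (b i / B) `^ (1 - t) * B `^ (1 - t).
  by rewrite -powRM ?divfK // ltW.
rewrite mulrACA mulrC.
by rewrite ler_wpM2l // powR_AGM // !ltW.
Qed.
End Hoelder.

(** * Lattice points: boxes, gcd sums and common neighbours *)

Definition supn (m : int * int) : nat := maxn `|m.1|%N `|m.2|%N.

Definition gcdc (m : int * int) : nat := gcdn `|m.1|%N `|m.2|%N.

Definition centered (N : nat) : seq int :=
  [seq (k%:Z - N%:Z) | k <- iota 0 N.*2.+1].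

Definition box (N : nat) : seq (int * int) :=
  [seq (i, j) | i <- centered N, j <- centered N].

Lemma mem_centered N (i : int) : (i \in centered N) = (`|i|%N <= N)%N.
Proof.
apply/mapP/idP => [[k]|iN]; first by rewrite mem_iota => ? ->; lia.
by exists `|(i + N%:Z)%R|%N; [rewrite mem_iota; lia | lia].
Qed.

Lemma centered_uniq N : uniq (centered N).
Proof. by rewrite map_inj_uniq ?iota_uniq // => i j; lia. Qed.

Lemma mem_box N m : (m \in box N) = (supn m <= N)%N.
Proof.
rewrite geq_max -!mem_centered; apply/allpairsP/andP => [[[i j] [? ? ->]] //|].
by case: m => i j /= [? ?]; exists (i, j).
Qed.

Lemma box_uniq N : uniq (box N).
Proof. by apply: allpairs_uniq; rewrite ?centered_uniq // => -[? ?] [? ?]. Qed.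

Lemma size_box N : size (box N) = (N.*2.+1 * N.*2.+1)%N.
Proof. by rewrite size_allpairs !size_map !size_iota. Qed.

Lemma supn_eq0 m : (supn m == 0%N) = (m == 0).
Proof. by case: m => i j; rewrite /supn xpair_eqE /=; apply/idP/idP; lia. Qed.

Lemma supnB m n N M :
  (supn m <= N)%N -> (supn n <= M)%N -> (supn (m - n)%R <= N + M)%N.
Proof. by case: m n => [a b] [c d]; rewrite /supn /=; lia. Qed.

Lemma size_progression (T : eqType) (s : seq T) (f : T -> int) (lo : int)
    (M a : nat) :
  (0 < a)%N -> uniq s -> {in s &, injective f} ->
  {in s, forall x, lo <= f x <= lo + M%:Z} ->
  {in s &, forall x y, (a %| `|f x - f y|)%N} ->
  (size s <= (M %/ a).+1)%N.
Proof.
move=> a0 us fi flo fa.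
apply: (@size_inj_leq T s (fun x => `|f x - lo| %/ a)%N) => //.
- move=> x y xs ys /= e; apply: fi => //.
  have := flo _ xs; have := flo _ ys; have := fa _ _ xs ys.
  set u := `|f x - lo|%N in e *; set v := `|f y - lo|%N in e *.
  move=> d hy hx; suff : u = v by lia.
  have {d} : (u == v %[mod a])%N.
    have [uv|vu] := leqP v u.
      by rewrite eqn_mod_dvd //; congr (_ %| _)%N: d; lia.
    by rewrite eq_sym eqn_mod_dvd ?(ltnW vu) //; congr (_ %| _)%N: d; lia.
  by move=> /eqP uv; rewrite (divn_eq u a) (divn_eq v a) e uv.
- move=> x xs; rewrite ltnS leq_div2r //; have := flo _ xs; lia.
Qed.

(** On a line of direction [d], the first coordinates are congruent modulo
    [d.1 / gcd d] and determine the point.  The count is multiplied out to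
    avoid a division. *)
Lemma size_lattice_line (s : seq (int * int)) (d : int * int) (c : int)
    (N : nat) :
  uniq s -> d.1 != 0 -> (`|d.1| <= N.*2)%N ->
  {in s, forall n, (`|n.1 - c| <= N)%N} ->
  {in s &, forall n n', (n.2 - n'.2) * d.1 = (n.1 - n'.1) * d.2} ->
  (size s * `|d.1| <= 4 * N * gcdc d)%N.
Proof.
move=> us d1 dN sc sl.
have g0 : (0 < gcdc d)%N by rewrite gcdn_gt0 absz_gt0 d1.
have gd : (gcdc d %| `|d.1|)%N by exact: dvdn_gcdl.
set a := (`|d.1| %/ gcdc d)%N.
have ag : (a * gcdc d)%N = `|d.1|%N by exact: divnK.
have a0 : (0 < a)%N by rewrite -(ltn_pmul2r g0) mul0n ag absz_gt0.
have adv : {in s &, forall n n', (a %| `|n.1 - n'.1|)%N}.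
  move=> n n' ns ns'; rewrite -(dvdn_pmul2r g0) ag /gcdc muln_gcdr dvdn_gcd.
  rewrite dvdn_mull //= -abszM -(sl _ _ ns ns') abszM dvdn_mull //.
have : (size s <= (N.*2 %/ a).+1)%N.
  apply: (@size_progression _ s (fun n => n.1) (c - N%:Z)) => //.
    move=> n n' ns ns' e; move: (sl _ _ ns ns'); rewrite e subrr mul0r.
    move=> /eqP; rewrite mulf_eq0 (negPf d1) orbF subr_eq0 => /eqP e2.
    by case: n n' e e2 {ns ns'} => [? ?] [? ?] /= -> ->.
  by move=> n /sc /=; lia.
have := leq_divM N.*2 a; rewrite -ag; move: (N.*2 %/ a)%N => Q Qa sQ.
have aN : (a <= N.*2)%N.
  by rewrite (leq_trans _ dN) // -ag leq_pmulr.
rewrite mulnA leq_pmul2r //.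
by apply: (@leq_trans (Q.+1 * a)); [rewrite leq_pmul2r | rewrite mulSn; lia].
Qed.

Section GcdSums.
Context {R : realType}.

Definition harmonic_sum (M : nat) : R := \sum_(g <- iota 1 M) g%:R^-1.

(** The sphere of radius [K + 1] has [8 (K + 1)] points, each contributing
    [1 / (K + 1)].  The origin contributes [0^-1 = 0]. *)
Lemma sum_box_inv K :
  \sum_(e <- box K) (supn e)%:R^-1 <= 8%:R * K%:R :> R.
Proof.
elim: K => [|K IH].
  by rewrite mulr0 /box /centered /= big_seq1 /= invr0.
rewrite (bigID (fun e => supn e <= K)%N) /= -[K.+1%:R]natr1 mulrDr mulr1 lerD //.
  apply: le_trans IH; rewrite -big_filter; apply: ler_sum_subset.
  - by rewrite filter_uniq ?box_uniq.
  - by move=> e; rewrite mem_filter !mem_box => /andP[].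
  - by move=> e; rewrite invr_ge0.
apply: (@le_trans _ _ (\sum_(e <- box K.+1 | ~~ (supn e <= K)%N) K.+1%:R^-1)).
  apply: ler_sum => e; rewrite -ltnNge => Ke.
  by rewrite lef_pV2 ?posrE ?ltr0n ?ler_nat //; lia.
rewrite -big_filter big_const_seq count_predT iter_addr_0.
rewrite -[X in X <= _]mulr_natl size_filter.
rewrite ler_pdivrMr ?ltr0n // -natrM ler_nat.
have := count_predC (fun e => supn e <= K)%N (box K.+1).
have : (size (box K) <= count (fun e => supn e <= K)%N (box K.+1))%N.
  rewrite -size_filter uniq_leq_size ?box_uniq // => e.
  by rewrite mem_filter !mem_box => eK; rewrite eK leqW.
rewrite !size_box /predC /=; move: (count _ _) (count _ _) => x y; lia.
Qed.

(** Writing [d = g e] with [g = gcd d] turns the summand into [1 / |e|], and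
    [e] ranges over a box of radius at most [M / g]. *)
Lemma sum_box_gcd M :
  \sum_(d <- box M) (gcdc d)%:R / (supn d)%:R
    <= 8%:R * M%:R * harmonic_sum M :> R.
Proof.
rewrite (eq_big_seq (fun d => \sum_(g <- iota 1 M | gcdc d == g)
  g%:R / (supn d)%:R)); last first.
  move=> d; rewrite mem_box => dM; have [d0|d0] := posnP (gcdc d).
    rewrite d0 mul0r big_seq_cond big1 // => g; rewrite mem_iota; lia.
  rewrite -big_filter (perm_big [:: gcdc d]) ?big_seq1 //.
  rewrite uniq_perm ?filter_uniq ?iota_uniq // => g.
  rewrite mem_filter mem_iota inE eq_sym andb_idr // => /eqP ->.
  rewrite d0 add1n ltnS /=; apply: leq_trans dM; rewrite /gcdc /supn in d0 *.
  have [->|h] := posnP `|d.1|%N; first by rewrite gcd0n max0n.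
  by rewrite (leq_trans (dvdn_leq h (dvdn_gcdl _ _))) // leq_maxl.
under eq_bigr do rewrite big_mkcond.
rewrite exchange_big /= /harmonic_sum mulr_sumr [leLHS]big_seq [leRHS]big_seq.
apply: ler_sum => g; rewrite mem_iota => /andP[g0 _].
rewrite -big_mkcond -big_filter.
apply: (@le_trans _ _ (\sum_(e <- box (M %/ g)) (supn e)%:R^-1)).
  have K : {in [seq d <- box M | gcdc d == g], forall d,
      d = ((d.1 %/ g)%Z * g%:Z, (d.2 %/ g)%Z * g%:Z)}.
    move=> d; rewrite mem_filter => /andP[/eqP gd _].
    rewrite !divzK ?dvdzE /= -?gd ?dvdn_gcdl ?dvdn_gcdr //; by case: (d).
  have S : {in [seq d <- box M | gcdc d == g], forall d,
      supn d = (supn ((d.1 %/ g)%Z, (d.2 %/ g)%Z) * g)%N}.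
    by move=> d /K {1}->; rewrite /supn /= !abszM /= maxnMl.
  apply: (@ler_sum_inj _ _ _ _ _ (fun d => ((d.1 %/ g)%Z, (d.2 %/ g)%Z))).
  - by rewrite filter_uniq ?box_uniq.
  - by move=> d d' /K dE /K d'E [e1 e2]; rewrite dE d'E e1 e2.
  - move=> d dg; rewrite mem_box leq_divRL // -S //.
    by move: dg; rewrite mem_filter mem_box => /andP[].
  - move=> d /S ->; rewrite natrM invfM mulrCA divff ?mulr1 //.
    by rewrite pnatr_eq0 -lt0n.
  - by move=> e; rewrite invr_ge0.
apply: le_trans (sum_box_inv _) _; rewrite -mulrA ler_pM2l //.
by rewrite ler_pdivlMr ?ltr0n // -natrM ler_nat leq_divM.
Qed.

Lemma harmonic_sum_dyadic k : harmonic_sum (2 ^ k) <= 1 + k%:R.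
Proof.
elim: k => [|k IH]; first by rewrite /harmonic_sum /= big_seq1 addr0 invr1.
rewrite expnS mul2n -addnn /harmonic_sum iotaD big_cat /= -natr1 addrA lerD //.
apply: (@le_trans _ _ (\sum_(g <- iota (1 + 2 ^ k) (2 ^ k)) (2 ^ k)%:R^-1)).
  rewrite [leLHS]big_seq [leRHS]big_seq; apply: ler_sum => g.
  rewrite mem_iota => /andP[hg _].
  by rewrite lef_pV2 ?posrE ?ltr0n ?ler_nat ?expn_gt0 //; lia.
rewrite big_const_seq count_predT iter_addr_0.
by rewrite -[X in X <= _]mulr_natl size_iota divff.
Qed.

Lemma harmonic_sum_ge1 M : (0 < M)%N -> 1 <= harmonic_sum M.
Proof.
by case: M => // M _; rewrite /harmonic_sum /= big_cons invr1 lerDl sumr_ge0.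
Qed.

(** Up to the factor [9 N], a bound for the number of common neighbours of two
    points whose horizontal parts differ by [d].  The value at [0] reflects
    the [O(N^2)] neighbours of a single point. *)
Definition rho (N : nat) (d : int * int) : R :=
  if d == 0 then N%:R else (gcdc d)%:R / (supn d)%:R.

Lemma rho_gt0 N d : (0 < N)%N -> 0 < rho N d.
Proof.
move=> N0; rewrite /rho; case: eqVneq => [_|d0]; first by rewrite ltr0n.
rewrite divr_gt0 ?ltr0n //; last by rewrite lt0n supn_eq0.
by rewrite gcdn_gt0 !absz_gt0 -negb_and; case: d d0.
Qed.

Lemma rhoN N d : rho N (- d) = rho N d.
Proof. by rewrite /rho oppr_eq0 /gcdc /supn /= !abszN. Qed.

Lemma sum_rho N m : (0 < N)%N -> m \in box N ->
  \sum_(m' <- box N) rho N (m - m')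
    <= 17%:R * N%:R * harmonic_sum N.*2.
Proof.
move=> N0 mN.
apply: (@le_trans _ _ (\sum_(d <- box N.*2)
    ((if d == 0 then N%:R else 0) + (gcdc d)%:R / (supn d)%:R))).
  apply: (@ler_sum_inj _ _ _ _ _ (fun m' => m - m')).
  - exact: box_uniq.
  - by move=> a b _ _ /(can_inj (subKr m)).
  - move=> a; rewrite !mem_box in mN *; rewrite -addnn => aN; exact: supnB.
  - move=> a _; rewrite /rho; case: eqVneq => [_|_]; rewrite ?add0r // lerDl.
    by rewrite divr_ge0.
  - by move=> d; rewrite addr_ge0 ?divr_ge0 //; case: ifP.
rewrite big_split /= (bigD1_seq 0) ?mem_box ?box_uniq //= ?eqxx big1 ?addr0.
  2: by move=> d /negPf ->.
have := sum_box_gcd N.*2; have := @harmonic_sum_ge1 N.*2.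
rewrite double_gt0 => /(_ N0).
move: (harmonic_sum _) => H H1 S; apply: le_trans (lerD (lexx _) S) _.
rewrite -mul2n natrM; have : 1 <= N%:R :> R by rewrite ler1n.
by move: (N%:R : R) => n n1; nra.
Qed.

(** The neighbours of a point are determined by their horizontal part [n].
    For a common neighbour of two points over [a] and [b], the two vertical
    equations differ by [omega n (a - b) = c]: a line with direction [a - b],
    unless [a = b]. *)
Lemma common_neighbours_le N (s : seq (int * int)) (a b : int * int) (c : int) :
  (0 < N)%N -> uniq s ->
  {in s, forall n, (supn (n - a)%R <= N)%N /\ (supn (n - b)%R <= N)%N} ->
  {in s, forall n, omega n (a - b) = c} ->
  (size s)%:R <= 9%:R * N%:R * rho N (a - b).
Proof.
move=> N0 us sN sc; rewrite /rho; case: eqVneq => [ab|d0].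
  rewrite -!natrM ler_nat; have : (size s <= size (box N))%N.
    rewrite -(size_map (fun n => n - a)) uniq_leq_size //.
      by rewrite map_inj_uniq // => n n' /(can_inj (subrK _)).
    by move=> _ /mapP[n /sN[na _] ->]; rewrite mem_box.
  rewrite size_box; nia.
set d := a - b in sc d0 *.
have [->|[n0 n0s]] : s = [::] \/ exists n, n \in s.
    by case: (s) => [|n s']; [left | right; exists n; rewrite mem_head].
  by rewrite !mulr_ge0.
have dN : (supn d <= N.*2)%N.
  have [na nb] := sN _ n0s; rewrite -addnn.
  have -> : d = (n0 - b) - (n0 - a) by rewrite opprB [RHS]addrC addrA subrK.
  exact: supnB.
have D0 : 0 < (supn d)%:R :> R by rewrite ltr0n lt0n supn_eq0.
rewrite mulrA ler_pdivlMr // -!natrM ler_nat.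
suff : (size s * supn d <= 4 * N * gcdc d)%N.
  by move=> /leq_trans; apply; rewrite !leq_mul.
have line : {in s &, forall n n', (n.2 - n'.2) * d.1 = (n.1 - n'.1) * d.2}.
  move=> n n' ns n's; have := sc _ ns; rewrite -(sc _ n's) /omega.
  have linear (x y z w u v : int) :
    2 * (y * u - x * v) = 2 * (w * u - z * v) -> (y - w) * u = (x - z) * v by lia.
  exact: linear.
have [d21|d12] := leqP `|d.2|%N `|d.1|%N.
  have sd : supn d = `|d.1|%N by exact/maxn_idPl.
  rewrite sd; apply: (@size_lattice_line s d a.1) => //.
  - by rewrite -absz_eq0 -lt0n -sd -(ltr0n R).
  - by rewrite -sd.
  - by move=> n /sN[+ _]; rewrite geq_max => /andP[].
have sd : supn d = `|d.2|%N by apply/maxn_idPr/ltnW.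
rewrite sd -(size_map (fun n => (n.2, n.1))) /gcdc gcdnC.
apply: (@size_lattice_line _ (d.2, d.1) a.2) => //=.
- by rewrite map_inj_uniq // => -[? ?] [? ?] [-> ->].
- by rewrite -absz_eq0 -lt0n -sd -(ltr0n R).
- by rewrite -sd.
- by move=> _ /mapP[n /sN[+ _] ->]; rewrite geq_max => /andP[].
- by move=> _ _ /mapP[n ns ->] /mapP[n' n's ->] /=; rewrite (line n n').
Qed.
End GcdSums.

(** * The l^(3/2) -> l^3 bound at one scale *)

(** The right translate of [x] by the inverse of [(m, 0)] in the Heisenberg
    group. *)
Definition act (x : Z3) (m : int * int) : Z3 := (x.1 - m, x.2 - omega x.1 m).

Lemma omegaB n m m' : omega n (m - m') = omega n m - omega n m'.
Proof. by rewrite /omega /=; ring. Qed.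

Lemma triple_sum_sym (R : realType) (I : Type) (s : seq I)
    (W : I -> I -> I -> R) :
  \sum_(i <- s) \sum_(j <- s) \sum_(k <- s)
    (W i j k + W j i k + W i k j + W k i j + W j k i + W k j i)
  = 6%:R * \sum_(i <- s) \sum_(j <- s) \sum_(k <- s) W i j k.
Proof.
have swap12 (F : I -> I -> I -> R) :
    \sum_(i <- s) \sum_(j <- s) \sum_(k <- s) F j i k
    = \sum_(i <- s) \sum_(j <- s) \sum_(k <- s) F i j k.
  exact: exchange_big.
have swap23 (F : I -> I -> I -> R) :
    \sum_(i <- s) \sum_(j <- s) \sum_(k <- s) F i k j
    = \sum_(i <- s) \sum_(j <- s) \sum_(k <- s) F i j k.
  by apply: eq_bigr => i _; exact: exchange_big.
have e2 := swap12 W.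
have e3 := swap23 W.
have e4 := etrans (swap23 (fun i j k => W j i k)) e2.
have e5 := etrans (swap12 (fun i j k => W i k j)) e3.
have e6 := etrans (swap12 (fun i j k => W k i j)) e4.
under eq_bigr => i _ do (under eq_bigr => j _ do rewrite !big_split /=;
  rewrite !big_split /=).
rewrite !big_split /= e2 e3 e4 e5 e6; ring.
Qed.

Section CubeEstimate.
Context {R : realType}.

Definition avg (N : nat) (f : Z3 -> R) (x : Z3) : R :=
  \sum_(m <- box N) f (act x m).

(** An arithmetic-geometric mean inequality without its constant: the product
    of the six terms is [(h1 h2 h3)^12], and each of them is at most their
    sum. *)
Lemma six_term_AGM (r12 r13 r23 h1 h2 h3 : R) :
  0 < r12 -> 0 < r13 -> 0 < r23 -> 0 <= h1 -> 0 <= h2 -> 0 <= h3 ->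
  h1 ^+ 2 * h2 ^+ 2 * h3 ^+ 2 <=
    r13 / r12 * (h1 * h2) ^+ 3 + r23 / r12 * (h2 * h1) ^+ 3 +
    r12 / r13 * (h1 * h3) ^+ 3 + r23 / r13 * (h3 * h1) ^+ 3 +
    r12 / r23 * (h2 * h3) ^+ 3 + r13 / r23 * (h3 * h2) ^+ 3.
Proof.
move=> p12 p13 p23 h10 h20 h30.
set t1 := r13 / r12 * _; set t2 := r23 / r12 * _; set t3 := r12 / r13 * _.
set t4 := r23 / r13 * _; set t5 := r12 / r23 * _; set t6 := r13 / r23 * _.
have nng (r r' h h' : R) : 0 < r -> 0 < r' -> 0 <= h -> 0 <= h' ->
    0 <= r / r' * (h * h') ^+ 3.
  by move=> ? ? ? ?; rewrite mulr_ge0 ?divr_ge0 ?exprn_ge0 ?mulr_ge0 // ltW.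
have T1 : 0 <= t1 by exact: nng.
have T2 : 0 <= t2 by exact: nng.
have T3 : 0 <= t3 by exact: nng.
have T4 : 0 <= t4 by exact: nng.
have T5 : 0 <= t5 by exact: nng.
have T6 : 0 <= t6 by exact: nng.
have E : (h1 ^+ 2 * h2 ^+ 2 * h3 ^+ 2) ^+ 6 = t1 * t2 * t3 * t4 * t5 * t6.
  by rewrite /t1 /t2 /t3 /t4 /t5 /t6; field; rewrite !gt_eqF.
rewrite -(@ler_pXn2r _ 6) ?nnegrE ?mulr_ge0 ?exprn_ge0 ?addr_ge0 //.
rewrite {}E; clearbody t1 t2 t3 t4 t5 t6.
have -> (y : R) : y ^+ 6 = y * y * y * y * y * y by ring.
by rewrite !ler_pM ?mulr_ge0 //; lra.
Qed.

(** For fixed [y = act x i] and [z = act x j], the difference [i - j] is fixed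
    and the number of [x] is at most [9 N rho N (i - j)], which cancels the
    weight. *)
Lemma sum_weighted_pairs_le N (X : seq Z3) (G : Z3 -> R) :
  (0 < N)%N -> uniq X -> (forall y, 0 <= G y) ->
  (forall Y, uniq Y -> \sum_(y <- Y) G y <= 1) ->
  \sum_(x <- X) \sum_(i <- box N) \sum_(j <- box N)
     (rho N (i - j))^-1 * (G (act x i) * G (act x j)) <= 9%:R * N%:R.
Proof.
move=> N0 uX G0 G1.
(* the triple sum is indexed by the pairs (x, (i, j)), fibred over (y, z) *)
pose B2 := [seq (i, j) | i <- box N, j <- box N].
pose I := [seq (x, ij) | x <- X, ij <- B2].
pose Y := undup [seq act x m | x <- X, m <- box N].
pose F (i : Z3 * ((int * int) * (int * int))) :=
  (rho N (i.2.1 - i.2.2))^-1 * (G (act i.1 i.2.1) * G (act i.1 i.2.2)).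
have -> : \sum_(x <- X) \sum_(i <- box N) \sum_(j <- box N)
     (rho N (i - j))^-1 * (G (act x i) * G (act x j)) = \sum_(i <- I) F i.
  transitivity (\sum_(x <- X) \sum_(ij <- B2) F (x, ij)); last first.
    by rewrite [RHS]big_allpairs.
  by apply: eq_bigr => x _; rewrite [RHS]big_allpairs.
apply: (@le_trans _ _ (9%:R * N%:R *
    \sum_(u <- [seq (y, z) | y <- Y, z <- Y]) G u.1 * G u.2)); last first.
  have -> : \sum_(u <- [seq (y, z) | y <- Y, z <- Y]) G u.1 * G u.2
      = \sum_(y <- Y) \sum_(z <- Y) G y * G z by rewrite [LHS]big_allpairs.
  rewrite -[leRHS]mulr1 ler_wpM2l //.
  under eq_bigr do rewrite -mulr_sumr.
  have := G1 Y (undup_uniq _); rewrite -mulr_suml => h.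
  by rewrite -[leRHS]mulr1 ler_pM ?sumr_ge0.
apply: (@ler_sum_fibre _ _ _ _ (fun i => (act i.1 i.2.1, act i.1 i.2.2))).
- by apply: allpairs_uniq; rewrite ?undup_uniq // => -[? ?] [? ?].
- move=> _ /allpairsP[[x ij] /= [xX /allpairsP[[i j] /= [iB jB ->]] ->]] /=.
  by rewrite allpairs_f // mem_undup allpairs_f.
move=> [[a ta] [b tb]] /=.
pose P (i : Z3 * ((int * int) * (int * int))) :=
  (act i.1 i.2.1, act i.1 i.2.2) == ((a, ta), (b, tb)).
have PE i : P i -> [/\ i.1.1 - a = i.2.1, i.1.1 - b = i.2.2,
    ta = i.1.2 - omega i.1.1 i.2.1 & tb = i.1.2 - omega i.1.1 i.2.2].
  by case: i => [[n t] [i j]] /= /eqP[<- <- <- <-]; rewrite !subKr.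
rewrite -/P (eq_bigr (fun=> (rho N (a - b))^-1 * (G (a, ta) * G (b, tb)))).
  2: { move=> i Pi; rewrite /F; have [e1 e2 _ _] := PE _ Pi.
    have -> : i.2.1 - i.2.2 = - (a - b).
      by rewrite -e1 -e2 !opprB addrC addrA subrK.
    by rewrite rhoN; move: Pi; rewrite /P xpair_eqE => /andP[/eqP -> /eqP ->]. }
rewrite -big_filter big_const_seq count_predT iter_addr_0 -[X in X <= _]mulr_natl.
rewrite mulrA ler_wpM2r ?mulr_ge0 // ler_pdivrMr ?rho_gt0 //.
rewrite -(size_map (fun i => i.1.1)).
apply: (@common_neighbours_le _ _ _ _ _ (ta - tb)) => //.
- rewrite map_inj_in_uniq.
    rewrite filter_uniq //; do 2![apply: allpairs_uniq; rewrite ?box_uniq //;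
      last by move=> [? ?] [? ?]].
  move=> i i'; rewrite !mem_filter => /andP[/PE[ha hb ht _] _].
  move=> /andP[/PE[ha' hb' ht' _] _].
  move: i i' ha hb ht ha' hb' ht' => [[n t] [i j]] [[n' t'] [i' j']] /=.
  move=> <- <- -> <- <- e nn'; rewrite -nn' in e *.
  by move/(addIr _): e => ->.
- move=> _ /mapP[i + ->]; rewrite mem_filter => /andP[/PE[-> -> _ _]].
  by move=> /allpairsP[[x ij] /= [_ /allpairsP[[k l] /= [+ + ->]] ->]] /=;
    rewrite !mem_box.
- move=> _ /mapP[i + ->]; rewrite mem_filter => /andP[/PE[ha hb -> ->] _].
  have -> : a - b = i.2.2 - i.2.1 by rewrite -ha -hb opprB [RHS]addrC addrA subrK.
  by rewrite omegaB opprB [RHS]addrC addrA subrK.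
Qed.

(** The bound from [l^(3/2)] to [l^3]: with [f = h^2] the normalisation is
    [|| f ||_(3/2) <= 1], and no fractional power is needed. *)
Lemma sum_avg_cube_le N (X : seq Z3) (h : Z3 -> R) :
  (0 < N)%N -> uniq X -> (forall y, 0 <= h y) ->
  (forall Y, uniq Y -> \sum_(y <- Y) h y ^+ 3 <= 1) ->
  \sum_(x <- X) avg N (fun y => h y ^+ 2) x ^+ 3
    <= 918%:R * N%:R ^+ 2 * harmonic_sum N.*2.
Proof.
move=> N0 uX h0 h1; set H := harmonic_sum _.
pose W x i j k :=
  rho N (i - k) / rho N (i - j) * (h (act x i) * h (act x j)) ^+ 3.
apply: (@le_trans _ _ (\sum_(x <- X) 6%:R *
    \sum_(i <- box N) \sum_(j <- box N) \sum_(k <- box N) W x i j k)).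
  apply: ler_sum => x _; rewrite -triple_sum_sym /avg sum_cube.
  apply: ler_sum => i _; apply: ler_sum => j _; apply: ler_sum => k _.
  rewrite /W.
  have rhoC a b : rho N (a - b) = rho N (b - a) :> R by rewrite -rhoN opprB.
  rewrite [rho N (j - i)]rhoC [rho N (k - i)]rhoC [rho N (k - j)]rhoC.
  by apply: six_term_AGM; rewrite ?rho_gt0.
rewrite -mulr_sumr.
apply: (@le_trans _ _ (6%:R * \sum_(x <- X) \sum_(i <- box N) \sum_(j <- box N)
    17%:R * N%:R * H * ((rho N (i - j))^-1 *
      (h (act x i) ^+ 3 * h (act x j) ^+ 3)))).
  rewrite ler_wpM2l //; apply: ler_sum => x _.
  rewrite [leLHS]big_seq [leRHS]big_seq; apply: ler_sum => i iN.
  apply: ler_sum => j _; rewrite /W -mulr_suml -mulr_suml -mulrA exprMn.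
  rewrite ler_wpM2r ?sum_rho //.
  by rewrite !mulr_ge0 ?invr_ge0 ?exprn_ge0 // ltW // rho_gt0.
under eq_bigr => x _ do (under eq_bigr => i _ do rewrite -mulr_sumr;
  rewrite -mulr_sumr).
rewrite -mulr_sumr.
have := @sum_weighted_pairs_le N X (fun y => h y ^+ 3) N0 uX.
move=> /(_ (fun y => exprn_ge0 _ (h0 y)) h1).
have : 1 <= H by apply: harmonic_sum_ge1; rewrite double_gt0.
move: (\sum_(x <- X) _) => S H1 HS.
have : 17%:R * N%:R * H * S <= 17%:R * N%:R * H * (9%:R * N%:R).
  by rewrite ler_wpM2l // !mulr_ge0 // (le_trans _ H1).
by move: (N%:R : R) => n; nra.
Qed.

End CubeEstimate.

(** * Interpolation at one scale *)

Section SingleScale.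
Context {R : realType}.

Lemma powR_le1_anti (x p q : R) : 0 <= x <= 1 -> 0 <= p <= q -> x `^ q <= x `^ p.
Proof.
move=> /andP[]; rewrite le_eqVlt => /orP[/eqP <- _ /andP[p0 pq]|x0 x1 /andP[_]].
  have [q0|qN0] := eqVneq q 0; last by rewrite powR0 // powR_ge0.
  by have -> : p = q by apply/eqP; rewrite eq_le pq q0 p0.
by move/ger_powR; apply; rewrite x0.
Qed.

Lemma act_injr x : injective (act x).
Proof.
by move=> m m' /(congr1 (fun y : Z3 => x.1 - y.1)); rewrite /= !subKr.
Qed.

Lemma act_injl m : injective (act^~ m).
Proof.
move=> y y' e; have e1 : y.1 = y'.1 by exact: addIr (congr1 fst e).
have /addIr e2 : y.2 - omega y.1 m = y'.2 - omega y.1 m.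
  by rewrite [in RHS]e1; exact: (congr1 snd e).
by rewrite (surjective_pairing y) e1 e2 -surjective_pairing.
Qed.

Lemma avg_ge0 N (f : Z3 -> R) x : (forall y, 0 <= f y) -> 0 <= avg N f x.
Proof. by move=> f0; rewrite sumr_ge0. Qed.

Lemma avg_le1 N (F : Z3 -> R) x :
  (forall Y, uniq Y -> \sum_(y <- Y) F y <= 1) -> avg N F x <= 1.
Proof.
move=> F1; rewrite /avg; under eq_bigr do rewrite -[F _]/((F \o act x) _).
rewrite -(big_map (act x) predT) F1 // map_inj_uniq ?box_uniq //; exact: act_injr.
Qed.

Lemma sumr1_size (T : Type) (s : seq T) : \sum_(i <- s) 1 = (size s)%:R :> R.
Proof. by rewrite big_const_seq count_predT iter_addr_0. Qed.

Lemma size_box_le N : (0 < N)%N -> (size (box N))%:R <= 9%:R * N%:R ^+ 2 :> R.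
Proof. by rewrite size_box -natrX -natrM ler_nat => N0; nia. Qed.

Lemma sum_avg_le N X (F : Z3 -> R) : (0 < N)%N -> uniq X ->
  (forall Y, uniq Y -> \sum_(y <- Y) F y <= 1) ->
  \sum_(x <- X) avg N F x <= 9%:R * N%:R ^+ 2.
Proof.
move=> N0 uX F1; apply: (le_trans _ (size_box_le N0)).
rewrite -sumr1_size /avg exchange_big; apply: ler_sum => m _.
rewrite -(big_map (act^~ m) predT) F1 // map_inj_uniq //; exact: act_injl.
Qed.

(** The pointwise half of the interpolation: Hoelder's inequality on the box,
    with [F^(2/3)], [F] and the constant [1]. *)
Lemma avg_hoelder N (F : Z3 -> R) x (c v r : R) :
  (0 < N)%N -> (forall y, 0 <= F y) -> 0 < c -> 0 <= v -> 0 <= r ->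
  c + v + r = 1 ->
  avg N (fun y => F y `^ (2 / 3 * c + v)) x <=
    avg N (fun y => F y `^ (2 / 3)) x `^ c * avg N F x `^ v *
      (9%:R * N%:R ^+ 2) `^ r.
Proof.
move=> N0 F0 c0 v0 r0 cvr.
(* tau shares the weight 1 - c between F and the constant 1; it is 0 if c = 1 *)
pose tau := v / (1 - c).
have tauE : tau * (1 - c) = v.
  have [c1|cN1] := eqVneq c 1; first by rewrite c1 subrr mulr0; lra.
  by rewrite divfK // subr_eq0 eq_sym.
have tau01 : 0 <= tau <= 1.
  rewrite divr_ge0 //; last by lra.
  have [c1|cN1] := eqVneq c 1; first by rewrite /tau c1 subrr invr0 mulr0 ler01.
  have c1 : c < 1 by rewrite lt_neqAle cN1 /=; lra.
  by rewrite /tau ler_pdivrMr; lra.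
have c01 : 0 <= c <= 1 by apply/andP; split; lra.
have -> : avg N (fun y => F y `^ (2 / 3 * c + v)) x =
    \sum_(m <- box N) (F (act x m) `^ (2 / 3)) `^ c *
                      (F (act x m) `^ tau) `^ (1 - c).
  apply: eq_bigr => m _; rewrite -!powRrM tauE -powRD //.
  by apply/implyP => /eqP; lra.
apply: le_trans (hoelder_seq _ _ _ _) _ => //; try by move=> ?; exact: powR_ge0.
rewrite -mulrA ler_wpM2l ?powR_ge0 //.
have step : \sum_(m <- box N) F (act x m) `^ tau <=
    avg N F x `^ tau * (9%:R * N%:R ^+ 2) `^ (1 - tau).
  have -> : \sum_(m <- box N) F (act x m) `^ tau =
      \sum_(m <- box N) F (act x m) `^ tau * 1 `^ (1 - tau).
    by apply: eq_bigr => m _; rewrite powR1 mulr1.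
  apply: le_trans (hoelder_seq _ _ _ _) _ => //.
  rewrite ler_wpM2l ?powR_ge0 // ge0_ler_powR ?nnegrE ?sumr_ge0 //; first by lra.
  by rewrite sumr1_size; exact: size_box_le.
apply: le_trans (ge0_ler_powR _ _ _ step) _.
- by lra.
- by rewrite nnegrE sumr_ge0 // => ? _; rewrite powR_ge0.
- by rewrite nnegrE mulr_ge0 ?powR_ge0.
rewrite powRM ?powR_ge0 // -!powRrM tauE.
by have -> : (1 - tau) * (1 - c) = r by rewrite mulrBl tauE; lra.
Qed.

(** Interpolation in the variable [F = f^p], whose sum is at most [1].  The
    weights [c], [s], [u], [r] are the barycentric coordinates, with respect to
    the points [(2/3, 1/3)], [(1, 1)], [(1, 0)] and [(0, 0)], of the pair of
    exponents [(2 c / 3 + s + u, c / 3 + s)].  The point [(1, 0)] costs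
    nothing, because [avg N F <= 1]. *)
Lemma sum_avg_powR_le N X (F : Z3 -> R) (c s u r : R) :
  (0 < N)%N -> uniq X -> (forall y, 0 <= F y) ->
  (forall Y, uniq Y -> \sum_(y <- Y) F y <= 1) ->
  0 < c -> 0 <= s -> 0 <= u -> 0 <= r -> c + s + u + r = 1 ->
  \sum_(x <- X)
     avg N (fun y => F y `^ (2 / 3 * c + s + u)) x `^ (c / 3 + s)^-1
  <= ((918%:R * N%:R ^+ 2 * harmonic_sum N.*2) `^ (c / 3) *
      (9%:R * N%:R ^+ 2) `^ (s + r)) `^ (c / 3 + s)^-1.
Proof.
move=> N0 uX F0 F1 c0 s0 u0 r0 csur.
set b := c / 3 + s.
have b0 : 0 < b by rewrite /b; lra.
have bi0 : 0 <= b^-1 by rewrite invr_ge0 ltW.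
set M : R := 9%:R * N%:R ^+ 2.
have M0 : 0 <= M by rewrite mulr_ge0 ?exprn_ge0.
pose A0 x := avg N (fun y => F y `^ (2 / 3)) x.
pose A1 x := avg N F x.
have A00 x : 0 <= A0 x by apply: avg_ge0 => y; exact: powR_ge0.
have A10 x : 0 <= A1 x by exact: avg_ge0.
pose th := c / 3 / b.
have thE : 1 - th = s / b.
  rewrite /th; have -> : c / 3 = b - s by rewrite /b addrK.
  by rewrite mulrBl divff ?gt_eqF //; lra.
have th01 : 0 <= th <= 1.
  rewrite divr_ge0 ?(ltW b0) //=; last by lra.
  by rewrite -subr_ge0 thE divr_ge0 // ltW.
have pt x : avg N (fun y => F y `^ (2 / 3 * c + s + u)) x `^ b^-1 <=
    (A0 x ^+ 3) `^ th * A1 x `^ (1 - th) * M `^ (r / b).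
  have := @avg_hoelder N F x c (s + u) r N0 F0 c0.
  rewrite addrA [_ + (s + u)]addrA.
  move=> /(_ (addr_ge0 s0 u0) r0 csur) /(ge0_ler_powR bi0).
  rewrite !nnegrE avg_ge0 ?mulr_ge0 ?powR_ge0 //;
    last by move=> y; exact: powR_ge0.
  move=> /(_ erefl erefl) /le_trans; apply.
  rewrite powRM ?mulr_ge0 ?powR_ge0 // powRM ?powR_ge0 // -!powRrM -/M.
  rewrite ler_wpM2r ?powR_ge0 // -powR_mulrn // -powRrM.
  have -> : 3%:R * th = c / b by rewrite /th; field; rewrite gt_eqF.
  rewrite ler_wpM2l ?powR_ge0 //.
  (* as A1 x <= 1, its exponent (s + u) / b may be lowered to s / b *)
  rewrite powR_le1_anti ?A10 ?avg_le1 // thE divr_ge0 ?(ltW b0) //=.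
  by rewrite ler_wpM2r //; lra.
apply: le_trans (ler_sum _ (fun x _ => pt x)) _.
rewrite -mulr_suml powRM ?powR_ge0 // -!powRrM.
have -> : M `^ ((s + r) / b) = M `^ (1 - th) * M `^ (r / b).
  rewrite thE -powRD ?mulrDl //; apply/implyP => _.
  by rewrite mulf_neq0 // expf_neq0 // pnatr_eq0 -lt0n.
rewrite mulrA ler_wpM2r ?powR_ge0 //.
apply: le_trans (hoelder_seq _ _ _ _) _ => //.
  by move=> x; rewrite exprn_ge0.
have sum0 (G : Z3 -> R) : (forall x, 0 <= G x) -> 0 <= \sum_(x <- X) G x.
  by move=> G0; rewrite sumr_ge0.
have S0 : \sum_(x <- X) A0 x ^+ 3 <= 918%:R * N%:R ^+ 2 * harmonic_sum N.*2.
  have AE x : A0 x = avg N (fun y => (F y `^ 3^-1) ^+ 2) x.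
    by apply: eq_bigr => m _; rewrite -powR_mulrn ?powR_ge0 // -powRrM mulrC.
  under eq_bigr do rewrite AE.
  apply: sum_avg_cube_le => //; first by move=> y; exact: powR_ge0.
  move=> Y /F1; apply: le_trans; apply: ler_sum => y _.
  by rewrite -powR_mulrn ?powR_ge0 // -powRrM mulVf // powRr1.
have A30 : 0 <= \sum_(x <- X) A0 x ^+ 3.
  by apply: sum0 => x; rewrite exprn_ge0.
have K0 := le_trans A30 S0.
have [th0 th1] : 0 <= th /\ 0 <= 1 - th by case/andP: th01; rewrite subr_ge0.
apply: ler_pM; [exact: powR_ge0 | exact: powR_ge0 | |].
  exact: (ge0_ler_powR th0 A30 K0 S0).
exact: (ge0_ler_powR th1 (sum0 _ A10) M0 (sum_avg_le N0 uX F1)).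
Qed.

End SingleScale.

(** * Summation over the dyadic scales *)

Section Scales.
Context {R : realType}.

Definition dyadic_sum (lam : R) (J : nat) (f : Z3 -> R) (x : Z3) : R :=
  \sum_(j <- iota 0 J) (2 `^ (2 * lam)) ^- j * avg (2 ^ j) f x.

Lemma dyadic_sum_ge0 lam J f x :
  (forall y, 0 <= f y) -> 0 <= dyadic_sum lam J f x.
Proof.
move=> f0; rewrite sumr_ge0 // => j _.
by rewrite mulr_ge0 ?avg_ge0 // invr_ge0 exprn_ge0 // powR_ge0.
Qed.

Lemma geometric_sum_le (q : R) J : 0 <= q < 1 ->
  \sum_(j <- iota 0 J) q ^+ j <= (1 - q)^-1.
Proof.
move=> /andP[q0 q1]; rewrite -[leRHS]mul1r ler_pdivlMr ?subr_gt0 //.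
suff -> : (\sum_(j <- iota 0 J) q ^+ j) * (1 - q) = 1 - q ^+ J.
  by rewrite gerBl exprn_ge0.
elim: J => [|J IH]; first by rewrite big_nil expr0; ring.
by rewrite -[J.+1]addn1 iotaD big_cat mulrDl IH big_seq1 add0n exprD expr1; ring.
Qed.

(** Bernoulli's inequality; it absorbs the logarithm of the scale. *)
Lemma linear_le_geometric (P : R) j : 1 < P ->
  j.+2%:R <= (2 + (P - 1)^-1) * P ^+ j.
Proof.
move=> P1; have e0 : 0 < P - 1 by rewrite subr_gt0.
have bern : 1 + j%:R * (P - 1) <= P ^+ j.
  elim: j => [|j IH]; first by rewrite expr0; lra.
  rewrite exprSr -natr1; have j0 : 0 <= j%:R :> R by [].
  have Pj1 : 1 <= P ^+ j by apply: le_trans IH; rewrite lerDl mulr_ge0 // ltW.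
  move: (j%:R : R) (P ^+ j) j0 IH Pj1 => n Pj n0 IH Pj1; nra.
apply: (@le_trans _ _ ((2 + (P - 1)^-1) * (1 + j%:R * (P - 1)))); last first.
  by rewrite ler_wpM2l // addr_ge0 // invr_ge0 ltW.
have -> : (2 + (P - 1)^-1) * (1 + j%:R * (P - 1)) =
    2 + 2 * (j%:R * (P - 1)) + (P - 1)^-1 + j%:R by field; rewrite gt_eqF.
have : 0 <= j%:R * (P - 1) by rewrite mulr_ge0 // ltW.
have : 0 < (P - 1)^-1 by rewrite invr_gt0.
rewrite -addn2 natrD; lra.
Qed.

Lemma jensen_powR (I : eqType) (r : seq I) (w h : I -> R) (b : R) :
  0 < b <= 1 -> (forall i, 0 <= w i) -> (forall i, 0 <= h i) ->
  (\sum_(i <- r) w i * h i) `^ b^-1 <=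
    (\sum_(i <- r) w i * h i `^ b^-1) * (\sum_(i <- r) w i) `^ ((1 - b) / b).
Proof.
move=> /andP[b0 b1] w0 h0.
have s0 (f : I -> R) : (forall i, 0 <= f i) -> 0 <= \sum_(i <- r) f i.
  by move=> f0; rewrite sumr_ge0.
have wh0 i : 0 <= w i * h i `^ b^-1 by rewrite mulr_ge0 ?powR_ge0.
have -> : \sum_(i <- r) w i * h i =
    \sum_(i <- r) (w i * h i `^ b^-1) `^ b * w i `^ (1 - b).
  apply: eq_bigr => i _; rewrite powRM ?powR_ge0 // -powRrM mulVf ?gt_eqF //.
  have {1}-> : w i = w i `^ b * w i `^ (1 - b).
    by rewrite -powRD addrC subrK ?powRr1 // oner_eq0.
  by rewrite powRr1 // mulrAC.
have b01 : 0 <= b <= 1 by rewrite (ltW b0).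
have H := hoelder_seq r wh0 w0 b01.
apply: le_trans (ge0_ler_powR _ _ _ H) _; rewrite ?nnegrE ?mulr_ge0 ?powR_ge0 //.
- by rewrite invr_ge0 ltW.
- by apply: s0 => i; rewrite mulr_ge0 ?powR_ge0.
rewrite powRM ?powR_ge0 // -!powRrM mulfV ?gt_eqF // powRr1 //.
exact: s0.
Qed.

Lemma scale_constant_split (k k' n h p t : R) :
  0 <= k -> 0 <= k' -> 0 <= n -> n != 0 -> 0 <= h ->
  (k * n * h) `^ p * (k' * n) `^ t = (k `^ p * k' `^ t) * (n `^ (p + t) * h `^ p).
Proof.
move=> k0 k'0 n0 nN0 h0.
rewrite powRM ?mulr_ge0 // powRM // powRM // powRD ?nN0 ?implybT //; ring.
Qed.

(** Put [al = c / 3 + s + r], the exponent of the single-scale bound, and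
    [P = 2^(lam - al) > 1].  Then [2^(2 lam j) = 2^(2 al j) P^j P^j]: one factor
    [P^j] absorbs the logarithm, and the other gives the weights [P^-j] with
    which Jensen's inequality is applied to the sum over the scales. *)
Lemma dyadic_sum_powR_le (lam c s u r : R) :
  0 < c -> 0 <= s -> 0 <= u -> 0 <= r -> c + s + u + r = 1 ->
  c / 3 + s + r < lam ->
  exists K : R, forall (F : Z3 -> R) X J,
    (forall y, 0 <= F y) -> (forall Y, uniq Y -> \sum_(y <- Y) F y <= 1) ->
    uniq X ->
    \sum_(x <- X) dyadic_sum lam J (fun y => F y `^ (2 / 3 * c + s + u)) x
       `^ (c / 3 + s)^-1 <= K.
Proof.
move=> c0 s0 u0 r0 csur; set al := c / 3 + s + r => al_lt.
set b := c / 3 + s; have b0 : 0 < b by rewrite /b; lra.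
have b1 : 0 < b <= 1 by rewrite b0 /b; lra.
have bi0 : 0 <= b^-1 by rewrite invr_ge0 ltW.
pose P : R := 2 `^ (lam - al); pose A : R := 2 `^ (2 * al).
have P1 : 1 < P.
  have -> : 1 = 1 `^ (lam - al) :> R by rewrite powR1.
  by rewrite /P gt0_ltr_powR ?nnegrE ?subr_gt0 ?ltr1n.
have A0 : 0 < A by exact: powR_gt0.
have P0 : 0 < P by rewrite (lt_trans _ P1).
have lamE : 2 `^ (2 * lam) = A * P * P.
  rewrite /A /P -!powRD; first (by congr (_ `^ _); ring);
  by apply/implyP => _; rewrite pnatr_eq0.
pose C := 2 + (P - 1)^-1; pose K1 := 918%:R * 9%:R * C.
pose q := P^-1; pose W := (1 - q)^-1.
have q01 : 0 <= q < 1 by rewrite invr_ge0 invf_lt1 // P1 ltW.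
have W0 : 0 <= W by rewrite invr_ge0 subr_ge0; case/andP: q01 => _ /ltW.
have C0 : 0 <= C by rewrite addr_ge0 // invr_ge0 subr_ge0 ltW.
exists (W * K1 `^ b^-1 * W `^ ((1 - b) / b)) => F X J F0 F1 uX.
pose f (y : Z3) := F y `^ (2 / 3 * c + s + u); rewrite -/f.
have f0 y : 0 <= f y by exact: powR_ge0.
(* dyadic_sum is the sum of q ^+ j * h x j, and the sum of h x j `^ b^-1 over X
   is bounded uniformly in j *)
pose h x j := avg (2 ^ j) f x / (A ^+ j * P ^+ j).
have AP0 j : 0 < A ^+ j * P ^+ j by rewrite mulr_gt0 ?exprn_gt0.
have h0 x j : 0 <= h x j by rewrite divr_ge0 ?avg_ge0 // ltW.
have hsum j : \sum_(x <- X) h x j `^ b^-1 <= K1 `^ b^-1.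
  have N0 : (0 < 2 ^ j)%N by rewrite expn_gt0.
  have := sum_avg_powR_le N0 uX F0 F1 c0 s0 u0 r0 csur; rewrite -/b -/f.
  set H := harmonic_sum _; set B := _ * _ `^ (s + r) => S.
  have H1 : 1 <= H by apply: harmonic_sum_ge1; rewrite double_gt0.
  have Hj : H <= j.+2%:R.
    by rewrite /H -mul2n -expnS -nat1r harmonic_sum_dyadic.
  have BE : B <= K1 * (A ^+ j * P ^+ j).
    have n0 : 0 <= ((2 ^ j)%:R : R) ^+ 2 by rewrite exprn_ge0.
    have nA : (((2 ^ j)%:R : R) ^+ 2) `^ al = A ^+ j.
      have -> : ((2 ^ j)%:R : R) ^+ 2 = 2 `^ (j * 2)%:R.
        by rewrite powR_mulrn // natrX exprM.
      rewrite -powRrM natrM -mulrA mulrC powRrM powR_mulrn ?powR_ge0 //.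
    have n1 : ((2 ^ j)%:R : R) ^+ 2 != 0.
      by rewrite expf_neq0 // pnatr_eq0 expn_eq0.
    have E := scale_constant_split (c / 3) (s + r) (ler0n R 918) (ler0n R 9)
      n0 n1 (le_trans ler01 H1).
    have alE : c / 3 + (s + r) = al by rewrite /al addrA.
    rewrite alE nA in E.
    rewrite /B E {E n0 nA n1 alE}.
    have -> : K1 * (A ^+ j * P ^+ j) = (918%:R * 9%:R) * (C * (A ^+ j * P ^+ j)).
      by rewrite mulrA.
    apply: ler_pM; rewrite ?mulr_ge0 ?exprn_ge0 ?powR_ge0 ?(ltW A0) //.
      by apply: ler_pM; rewrite ?powR_ge0 // ler1_powR ?ler1n //; lra.
    rewrite mulrCA ler_wpM2l ?exprn_ge0 ?(ltW A0) //.
    apply: le_trans (linear_le_geometric _ P1); apply: le_trans Hj.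
    by rewrite ler1_powR //; lra.
  have -> : \sum_(x <- X) h x j `^ b^-1 =
      (\sum_(x <- X) avg (2 ^ j) f x `^ b^-1) * (A ^+ j * P ^+ j)^-1 `^ b^-1.
    rewrite mulr_suml; apply: eq_bigr => x _.
    by rewrite powRM ?avg_ge0 // invr_ge0 ltW.
  have B0 : 0 <= B by rewrite mulr_ge0 ?powR_ge0.
  apply: le_trans (ler_wpM2r (powR_ge0 _ _) S) _.
  rewrite -powRM ?invr_ge0 ?(ltW (AP0 j)) //.
  have BAP : B / (A ^+ j * P ^+ j) <= K1 by rewrite ler_pdivrMr.
  have BAP0 : 0 <= B / (A ^+ j * P ^+ j) by rewrite divr_ge0 // ltW.
  exact: (ge0_ler_powR bi0 BAP0 (le_trans BAP0 BAP) BAP).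
have pt x : dyadic_sum lam J f x `^ b^-1 <=
    (\sum_(j <- iota 0 J) q ^+ j * h x j `^ b^-1) * W `^ ((1 - b) / b).
  have q0 j : 0 <= q ^+ j by rewrite exprn_ge0 //; case/andP: q01.
  have -> : dyadic_sum lam J f x = \sum_(j <- iota 0 J) q ^+ j * h x j.
    apply: eq_bigr => j _; rewrite lamE /q /h !exprMn exprVn.
    by field; rewrite !expf_neq0 // gt_eqF.
  apply: le_trans (jensen_powR _ b1 q0 (h0 x)) _.
  rewrite ler_wpM2l //.
    by rewrite sumr_ge0 // => j _; rewrite mulr_ge0 ?powR_ge0.
  apply: ge0_ler_powR; rewrite ?nnegrE ?sumr_ge0 //.
    by rewrite divr_ge0 ?(ltW b0) // subr_ge0; case/andP: b1.
  exact: geometric_sum_le.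
apply: le_trans (ler_sum _ (fun x _ => pt x)) _.
rewrite -mulr_suml ler_wpM2r ?powR_ge0 // exchange_big /=.
under eq_bigr do rewrite -mulr_sumr.
apply: (@le_trans _ _ (\sum_(j <- iota 0 J) q ^+ j * K1 `^ b^-1)).
  apply: ler_sum => j _; rewrite ler_wpM2l // exprn_ge0 //; by case/andP: q01.
by rewrite -mulr_suml ler_wpM2r ?powR_ge0 // geometric_sum_le.
Qed.

Lemma enorm_ge_supn (m : int * int) : (supn m)%:R <= enorm R m.
Proof.
rewrite /supn; case: leqP => _; rewrite natr_absz intr_norm -sqrtr_sqr;
  by rewrite ler_wsqrtr // ?lerDl ?lerDr sqr_ge0.
Qed.

(** A point [m] with [2^(j-1) < |m| <= 2^j] is counted by the average at scale
    [2^j].  The bound holds for all large [J], so that one [J] can serve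
    finitely many [x]. *)
Lemma dyadic_majorant lam (x : Z3) (f : Z3 -> R) (Ms : seq (int * int)) :
  0 < lam -> uniq Ms -> {in Ms, forall m, m != 0} -> (forall y, 0 <= f y) ->
  exists J0, forall J, (J0 <= J)%N ->
  \sum_(m <- Ms) f (act x m) / enorm R m `^ (2 * lam)
    <= 2 `^ (2 * lam) * dyadic_sum lam J f x.
Proof.
move=> lam0 uM M0 f0; exists (\sum_(m <- Ms) supn m).+1 => J J0.
have a0 j : 0 <= (2 `^ (2 * lam)) ^- j :> R.
  by rewrite invr_ge0 exprn_ge0 // powR_ge0.
apply: (@le_trans _ _ (\sum_(m <- Ms) f (act x m) * (2 `^ (2 * lam) *
    \sum_(j <- iota 0 J)
      if (supn m <= 2 ^ j)%N then (2 `^ (2 * lam)) ^- j else 0))).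
  rewrite [leLHS]big_seq [leRHS]big_seq; apply: ler_sum => m mM.
  rewrite ler_wpM2l //.
  have sm0 : (0 < supn m)%N by rewrite lt0n supn_eq0 M0.
  set j := up_log 2 (supn m).
  have jJ : j \in iota 0 J.
    rewrite mem_iota /= add0n; apply: leq_trans J0; rewrite ltnS.
    apply: (@leq_trans (supn m)); first by rewrite up_log_min // ltnW // ltn_expl.
    by rewrite (bigD1_seq m) //= leq_addr.
  apply: (@le_trans _ _ (2 `^ (2 * lam) * (2 `^ (2 * lam)) ^- j)).
    have e0 : 0 < enorm R m.
      by apply: lt_le_trans (enorm_ge_supn m); rewrite ltr0n.
    rewrite -[leLHS]mul1r ler_pdivrMr ?powR_gt0 // mulrAC.
    rewrite ler_pdivlMr ?exprn_gt0 ?powR_gt0 // mul1r.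
    have -> : (2 `^ (2 * lam)) ^+ j = (2 ^+ j) `^ (2 * lam) :> R.
      by rewrite -!powR_mulrn ?powR_ge0 // -!powRrM mulrC.
    rewrite -powRM ?(ltW e0) //; apply: ge0_ler_powR.
    - by rewrite mulr_ge0 // ltW.
    - by rewrite nnegrE exprn_ge0.
    - by rewrite nnegrE mulr_ge0 // ltW.
    have := enorm_ge_supn m; rewrite -(ler_pM2l (ltr0n R 2)); apply: le_trans.
    rewrite -natrX -natrM ler_nat.
    rewrite /j; have [s1|s1] := leqP (supn m) 1.
      by have -> : supn m = 1%N by [lia]; rewrite up_log1.
    have := @up_log_gtn 2 _ isT s1; have := @up_log_gt0 2 (supn m); rewrite s1.
    by case: (up_log _ _) => // k _ /=; rewrite expnS; lia.
  rewrite ler_wpM2l ?powR_ge0 // (bigD1_seq j) ?iota_uniq //=.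
  rewrite up_logP // lerDl sumr_ge0 // => i _; by case: ifP.
under eq_bigr do rewrite mulrCA.
rewrite -mulr_sumr ler_wpM2l ?powR_ge0 //.
under eq_bigr do rewrite mulr_sumr.
rewrite exchange_big; apply: ler_sum => j _ /=.
rewrite mulr_sumr.
have -> : \sum_(m <- Ms) f (act x m) *
    (if (supn m <= 2 ^ j)%N then (2 `^ (2 * lam)) ^- j else 0) =
    \sum_(m <- [seq m <- Ms | (supn m <= 2 ^ j)%N])
      (2 `^ (2 * lam)) ^- j * f (act x m).
  rewrite big_filter [RHS]big_mkcond; apply: eq_bigr => m _.
  by case: ifP => _; [rewrite mulrC | rewrite mulr0].
apply: ler_sum_subset; first by rewrite filter_uniq.
- by move=> m; rewrite mem_filter mem_box => /andP[].
- by move=> m; rewrite mulr_ge0.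
Qed.

End Scales.

(** * Norms for the counting measure, exponents *)

Section CountingNorm.
Context {R : realType}.
Local Open Scope ereal_scope.

Notation mu := (@counting Z3 R).

Lemma measurable_fun_Z3 (d' : measure_display) (U : sigmaRingType d')
    (D : set Z3) (f : Z3 -> U) : measurable_fun (T := Z3) D f.
Proof. by move=> _ B _. Qed.

Hint Resolve measurable_fun_Z3 : core.

Lemma integral_Z3_set1 (x : Z3) (g : Z3 -> R) :
  \int[mu]_(y in [set x]%classic) (g y)%:E = (g x)%:E.
Proof.
rewrite (eq_integral (cst (g x)%:E)); last by move=> y; rewrite inE => ->.
by rewrite integral_cst //= /counting asboolT // fset_set1 finmap.cardfs1 mule1.
Qed.

Lemma sum_le_integral_Z3 (g : Z3 -> R) (Y : seq Z3) :
  (forall x, (0 <= g x)%R) -> uniq Y ->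
  (\sum_(y <- Y) g y)%R%:E <= \int[mu]_x (g x)%:E.
Proof.
move=> g0 uY.
have gE0 y : 0 <= (g y)%:E by rewrite lee_fin.
have -> : (\sum_(y <- Y) g y)%R%:E =
    \int[mu]_(x in (\big[setU/set0]_(y <- Y) [set y])%classic) (g x)%:E.
  rewrite ge0_integral_bigsetU //.
  - by rewrite -sumEFin; apply: eq_bigr => y _; rewrite integral_Z3_set1.
  - by move=> y z _ _ [w [/= -> ->]].
apply: ge0_subset_integral => //.
Qed.

(** [Z3] is exhausted by the fibres of [pickle], which have at most one
    point. *)
Lemma integral_Z3_le (g : Z3 -> R) (K : R) :
  (forall x, (0 <= g x)%R) ->
  (forall Y, uniq Y -> (\sum_(y <- Y) g y <= K)%R) ->
  \int[mu]_x (g x)%:E <= K%:E.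
Proof.
move=> g0 gK.
have gE0 y : 0 <= (g y)%:E by rewrite lee_fin.
pose F k : set Z3 := [set x | pickle x = k]%classic.
have FT : [set: Z3]%classic = (\bigcup_k F k)%classic.
  by apply/seteqP; split => // x _; exists (pickle x).
rewrite FT ge0_integral_bigcup //; last by move=> i j _ _ [x [<- <-]].
apply: lime_le.
  by apply: is_cvg_nneseries => n _ _; exact: integral_ge0.
apply: nearW => n.
have -> : \sum_(0 <= i < n) \int[mu]_(x in F i) (g x)%:E =
    (\sum_(y <- pmap (@pickle_inv Z3) (iota 0 n)) g y)%:E.
  rewrite /index_iota subn0; elim: (iota 0 n) => [|k s IH].
    by rewrite !big_nil.
  rewrite big_cons IH /=.
  case kE : (@pickle_inv Z3 k) => [x|] /=.
    have -> : F k = [set x]%classic.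
      apply/seteqP; split => y /=.
        by move=> yk; move: kE; rewrite -yk pickleK_inv => -[].
      move=> ->; have := @pickle_invK Z3 k; by rewrite kE.
    by rewrite integral_Z3_set1 big_cons EFinD.
  have -> : F k = set0%classic.
    by apply/seteqP; split => y //= yk; move: kE; rewrite -yk pickleK_inv.
  by rewrite integral_set0 add0e.
rewrite lee_fin; apply: gK.
apply: pmap_uniq (iota_uniq _ _); exact: pickle_invK.
Qed.

Lemma normc_ge0 (z : R[i]) : (0 <= Normc.normc z)%R.
Proof. by case: z => a b; rewrite sqrtr_ge0. Qed.

Lemma lpnorm_finE (s : R) (g : Z3 -> R[i]) :
  lpnorm s%:E g = ((\int[mu]_x (Normc.normc (g x) `^ s)%R%:E) `^ s^-1)%E.
Proof.
rewrite /lpnorm unlock /Lnorm /=; congr (_ `^ _); apply: eq_integral => x _.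
by rewrite ger0_norm ?normc_ge0.
Qed.

Lemma lpnorm_fin_le (s : R) (g : Z3 -> R[i]) (B : R) :
  (0 < s)%R -> (0 <= B)%R ->
  (forall Y, uniq Y -> (\sum_(y <- Y) Normc.normc (g y) `^ s <= B `^ s)%R) ->
  lpnorm s%:E g <= B%:E.
Proof.
move=> s0 B0 gB; rewrite lpnorm_finE.
have -> : B%:E = ((B `^ s)%R%:E `^ s^-1)%E.
  by rewrite poweR_EFin -powRrM divff ?gt_eqF // powRr1.
apply: gt0_ler_poweR.
- by rewrite invr_ge0 ltW.
- rewrite in_itv /= leey andbT; apply: integral_ge0 => x _.
  by rewrite lee_fin powR_ge0.
- by rewrite in_itv /= leey andbT lee_fin powR_ge0.
- by apply: integral_Z3_le => // x; exact: powR_ge0.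
Qed.

Lemma lpnorm_infty_le (g : Z3 -> R[i]) (B : R) :
  (0 <= B)%R -> (forall y, (Normc.normc (g y) <= B)%R) ->
  lpnorm +oo g <= B%:E.
Proof.
move=> B0 gB; rewrite /lpnorm unlock /Lnorm /=; case: ifP => _ //.
apply/ess_supP; apply: nearW => y /=.
by rewrite lee_fin ger0_norm ?normc_ge0.
Qed.

Lemma lpnorm_infty_or_sums_le (r : R) (f : Z3 -> R[i]) : (0 < r)%R ->
  lpnorm r%:E f = +oo \/ exists v : R, [/\ (0 <= v)%R,
    lpnorm r%:E f = (v `^ r^-1)%R%:E &
    forall Y, uniq Y -> (\sum_(y <- Y) Normc.normc (f y) `^ r <= v)%R].
Proof.
move=> r0; rewrite lpnorm_finE; set V := integral _ _ _.
have V0 : 0 <= V by apply: integral_ge0 => x _; rewrite lee_fin powR_ge0.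
have VY Y : uniq Y -> (\sum_(y <- Y) Normc.normc (f y) `^ r)%R%:E <= V.
  by move=> uY; apply: sum_le_integral_Z3 => // x; exact: powR_ge0.
case: V V0 VY => [v| |] //; last first.
  by left; rewrite poweRyr // invr_eq0 gt_eqF.
by rewrite lee_fin => v0 vY; right; exists v; split.
Qed.

End CountingNorm.

Section Reduction.
Context {R : realType}.

Lemma Tlam_normc_le (lam : R) (f : Z3 -> R[i]) (x : Z3) :
  finitely_supported f ->
  exists Ms : seq (int * int), [/\ uniq Ms, {in Ms, forall m, m != 0} &
    Normc.normc (Tlam lam f x) <=
    \sum_(m <- Ms) Normc.normc (f (act x m)) / enorm R m `^ (2 * lam)].
Proof.
move=> ff; have := finite_support_Tlam lam x ff.
set D := (_ `&` _)%classic => fin; exists (finmap.enum_fset (fset_set D)).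
split.
- exact: finmap.fset_uniq.
- by move=> m; rewrite in_fset_set // inE => -[].
rewrite /Tlam fsbig_supp fsbig_finite //=.
have normc_sum (s' : seq (int * int)) (F : int * int -> R[i]) :
    Normc.normc (\sum_(m <- s') F m) <= \sum_(m <- s') Normc.normc (F m).
  elim: s' => [|m s' IH]; first by rewrite !big_nil Normc.normc0.
  by rewrite !big_cons; apply: le_trans (le_normcD _ _) _; rewrite lerD2l.
apply: le_trans (normc_sum _ _) _; apply: ler_sum => m _.
rewrite Normc.normcM Normc.normcV /Normc.normc /= expr0n addr0 sqrtr_sqr.
by rewrite ger0_norm // powR_ge0.
Qed.

(** With [l < lam] such that [(x, y)] still satisfies the closed conditions for
    [l]: if [l <= 1/3], the point [(1 - l, l)] lies on the segment from [(1, 0)]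
    to [(2/3, 1/3)]; if [l > 1/3], the relevant point [(a, a - (1 - l) / 2)] lies
    in the triangle spanned by [(2/3, 1/3)], [(1, 1)] and [(0, 0)].  Passing from
    [(x, y)] to that point uses that the [l^p] norms decrease in [p]. *)
Lemma exponents_exist (lam x y : R) :
  0 < lam -> lam < 1 -> x <= 1 -> 0 <= y ->
  y < x - 2^-1 * (1 - lam) -> y < lam -> 1 - lam < x ->
  exists c s u r : R, [/\ [/\ 0 < c, 0 <= s, 0 <= u & 0 <= r],
    c + s + u + r = 1, c / 3 + s + r < lam,
    2 / 3 * c + s + u <= x & y <= c / 3 + s].
Proof.
move=> lam0 lam1 x1 y0 yx ylam xlam.
pose l := Num.max (Num.max y (1 - x)) (Num.max (1 - 2 * (x - y)) (lam / 2)).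
have [l1 l2 l3 l4] : [/\ y <= l, 1 - x <= l, 1 - 2 * (x - y) <= l & lam / 2 <= l].
  by rewrite /l !le_max !lexx !orbT.
have llam : l < lam by rewrite /l !gt_max ylam; apply/and3P; split; lra.
clearbody l.
have [l13|l13] := lerP l 3^-1.
  by exists (3 * l), 0, (1 - 3 * l), 0; split; [split|..]; lra.
pose a := Num.min x ((1 + l) / 2).
have [ax al] : a <= x /\ a <= (1 + l) / 2 by rewrite /a !ge_min !lexx orbT.
have ay : y + (1 - l) / 2 <= a by rewrite /a le_min; apply/andP; split; lra.
have a1 : 1 - l <= a by rewrite /a le_min; apply/andP; split; lra.
by exists (3 * (1 - l) / 2), (a - (1 - l)), 0, ((1 + l) / 2 - a);
  split; [split|..]; lra.
Qed.

End Reduction.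

(** * The bound for T *)

Section RealEstimate.
Context {R : realType}.

Lemma Tlam_dyadic_le (lam n a : R) (f : Z3 -> R[i]) (F : Z3 -> R) (X : seq Z3) :
  0 < lam -> 0 <= n -> finitely_supported f ->
  (forall y, Normc.normc (f y) <= n * F y `^ a) ->
  exists J, {in X, forall x, Normc.normc (Tlam lam f x) <=
    n * (2 `^ (2 * lam) * dyadic_sum lam J (fun y => F y `^ a) x)}.
Proof.
move=> lam0 n0 ff fF.
have pt x : exists J0, forall J, (J0 <= J)%N -> Normc.normc (Tlam lam f x) <=
    n * (2 `^ (2 * lam) * dyadic_sum lam J (fun y => F y `^ a) x).
  have [Ms [uM M0 TM]] := Tlam_normc_le lam x ff.
  have F0 y : 0 <= F y `^ a by exact: powR_ge0.
  have [J0 hJ0] := dyadic_majorant x lam0 uM M0 F0.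
  exists J0 => J /hJ0 hJ; apply: le_trans TM _.
  apply: le_trans (ler_wpM2l n0 hJ); rewrite mulr_sumr; apply: ler_sum => m _.
  by rewrite mulrA ler_wpM2r // invr_ge0 powR_ge0.
suff [J0 hJ0] : exists J0, forall J, (J0 <= J)%N ->
    {in X, forall x, Normc.normc (Tlam lam f x) <=
      n * (2 `^ (2 * lam) * dyadic_sum lam J (fun y => F y `^ a) x)}.
  by exists J0; exact: hJ0.
elim: X => [|x X [J1 h1]]; first by exists 0%N.
have [J2 h2] := pt x; exists (maxn J1 J2) => J.
rewrite geq_max => /andP[/h1 H1 /h2 H2] y; rewrite inE => /orP[/eqP ->|] //.
exact: H1.
Qed.

Lemma le1_of_sum_powR_le1 (e : R) (E : Z3 -> R) (X : seq Z3) (x : Z3) :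
  0 < e -> (forall z, 0 <= E z) -> x \in X ->
  \sum_(z <- X) E z `^ e <= 1 -> E x <= 1.
Proof.
move=> e0 E0 xX EX; rewrite leNgt; apply/negP => Ex.
have : E x `^ e <= 1.
  have <- : \sum_(z <- [:: x]) E z `^ e = E x `^ e by rewrite big_seq1.
  apply: le_trans EX; apply: ler_sum_subset => // [z|z]; last exact: powR_ge0.
  by rewrite inE => /eqP ->.
have -> : 1 = 1 `^ e :> R by rewrite powR1.
by rewrite leNgt gt0_ltr_powR ?nnegrE.
Qed.

(** [F] is [|f|^p] divided by the bound [v] for its sums.  As [F <= 1], lowering the
    exponent of [F] from [1/p] to [a] only increases the power.  When [v = 0],
    both sides of the bound vanish. *)
Lemma normalized_profile (p a v : R) (f : Z3 -> R[i]) :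
  0 < p -> a <= p^-1 -> 0 <= v ->
  (forall Y, uniq Y -> \sum_(y <- Y) Normc.normc (f y) `^ p <= v) ->
  exists F : Z3 -> R, [/\ forall y, 0 <= F y,
    forall Y, uniq Y -> \sum_(y <- Y) F y <= 1 &
    forall y, Normc.normc (f y) <= v `^ p^-1 * F y `^ a].
Proof.
move=> p0 ap v0 fv; exists (fun y => Normc.normc (f y) `^ p / v).
have fp0 y : 0 <= Normc.normc (f y) `^ p by exact: powR_ge0.
have fp1 y : Normc.normc (f y) `^ p <= v.
  by have := fv [:: y] isT; rewrite big_seq1.
have fE y : Normc.normc (f y) = (Normc.normc (f y) `^ p) `^ p^-1.
  by rewrite -powRrM divff ?gt_eqF // powRr1 ?normc_ge0.
have pi0 : 0 < p^-1 by rewrite invr_gt0.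
move: v0; rewrite le_eqVlt => /orP[/eqP v0|v0].
  have f0 y : Normc.normc (f y) = 0.
    rewrite fE (_ : _ `^ p = 0) ?powR0 ?gt_eqF //.
    by apply/eqP; rewrite eq_le fp0 andbT v0.
  split => [y|Y _|y]; rewrite -v0 ?invr0 ?mulr0 //.
    by rewrite big1 // => i _; rewrite mulr0.
  by rewrite f0 mulr_ge0 ?powR_ge0.
split => [y|Y uY|y].
- by rewrite divr_ge0 // ltW.
- by rewrite -mulr_suml ler_pdivrMr // mul1r fv.
set F := _ / v.
have F01 : 0 <= F <= 1 by rewrite divr_ge0 ?(ltW v0) //= ler_pdivrMr // mul1r.
have -> : Normc.normc (f y) = v `^ p^-1 * F `^ p^-1.
  by rewrite -powRM ?(ltW v0) //; [rewrite mulrC divfK ?gt_eqF | case/andP: F01].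
rewrite ler_wpM2l ?powR_ge0 //; case/andP: F01; rewrite le_eqVlt.
move=> /orP[/eqP <- _|F0 F1]; first by rewrite powR0 ?powR_ge0 ?gt_eqF.
by apply: ger_powR => //; rewrite F0.
Qed.

End RealEstimate.

Local Open Scope ereal_scope.

Theorem theorem2 (R : realType) (lam : R) (p q : \bar R)
    (lam_gt0 : (0 < lam)%R) (lam_lt1 : (lam < 1)%R)
    (p_ge1 : 1 <= p) (q_ge1 : 1 <= q)
    (cond_i : q^-1 < p^-1 - (2^-1 * (1 - lam))%R%:E)
    (cond_iiq : q^-1 < lam%:E) (cond_iip : (1 - lam)%R%:E < p^-1) :
  exists A : R, forall f : Z3 -> R[i], finitely_supported f ->
    lpnorm q (Tlam lam f) <= A%:E * lpnorm p f.
Proof.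
have lam'_gt0 : (0 < 1 - lam)%R by rewrite subr_gt0.
case: p p_ge1 cond_i cond_iip => [p| |] //; last first.
  by rewrite invey lte_fin => _ _ /(lt_trans lam'_gt0); rewrite ltxx.
rewrite lee_fin => p1; have p0 : (0 < p)%R by exact: lt_le_trans p1.
rewrite inver gt_eqF // -EFinB lte_fin => cond_i cond_iip.
(* y stands for 1/q, with y = 0 when q is infinite *)
have [y [y0 y1 ylam qy]] : exists y : R, [/\ (0 <= y)%R,
    (y < p^-1 - 2^-1 * (1 - lam))%R, (y < lam)%R &
    q = +oo \/ exists2 s : R, q = s%:E & (0 < s)%R /\ (y = s^-1)%R].
  case: q q_ge1 cond_i cond_iiq => [s| |] //.
    rewrite lee_fin => s1; have s0 : (0 < s)%R by exact: lt_le_trans s1.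
    rewrite inver gt_eqF // !lte_fin => h1 h2.
    exists (s^-1)%R; split => //; first by rewrite invr_ge0 ltW.
    by right; exists s.
  rewrite invey !lte_fin => _ h1 h2; exists 0%R; split => //; by left.
have pi1 : (p^-1 <= 1)%R by rewrite invf_le1.
have [c [s [u [r [[c0 s0 u0 r0] csur al ax yb]]]]] :=
  exponents_exist lam_gt0 lam_lt1 pi1 y0 y1 ylam cond_iip.
have [K hK] := dyadic_sum_powR_le c0 s0 u0 r0 csur al.
set a := (2 / 3 * c + s + u)%R in ax hK; set b := (c / 3 + s)%R in yb hK.
have b0 : (0 < b)%R by rewrite /b; lra.
pose K' : R := Num.max 1%R K.
have K'1 : (1 <= K')%R by rewrite /K' le_max lexx.
have K'0 : (0 < K')%R by exact: lt_le_trans K'1.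
have KK' : (K <= K')%R by rewrite /K' le_max lexx orbT.
pose A := (2 `^ (2 * lam) * K' `^ b)%R.
have A0 : (0 < A)%R by rewrite mulr_gt0 ?powR_gt0.
exists A => f ff.
have [->|[v [v0 -> fv]]] := lpnorm_infty_or_sums_le f p0.
  by rewrite mulry gtr0_sg // mul1e leey.
have [F [F0 F1 fF]] := normalized_profile p0 ax v0 fv.
set n := (v `^ p^-1)%R in fF *; have n0 : (0 <= n)%R by exact: powR_ge0.
(* Since E <= 1 on X, its l^q sums for q >= b^-1 are bounded by the l^(b^-1) one;
   this covers q infinite as well. *)
have key X : uniq X -> exists E : Z3 -> R, [/\ forall x, (0 <= E x)%R,
    {in X, forall x, (Normc.normc (Tlam lam f x) <= A * n * E x)%R} &
    (\sum_(x <- X) E x `^ b^-1 <= 1)%R].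
  move=> uX; have [J TJ] := Tlam_dyadic_le X lam_gt0 n0 ff fF.
  pose D := dyadic_sum lam J (fun y => F y `^ a)%R.
  have D0 x : (0 <= D x)%R by apply: dyadic_sum_ge0 => z; exact: powR_ge0.
  exists (fun x => D x / K' `^ b)%R; split => [x|x /TJ|].
  - by rewrite divr_ge0 ?powR_ge0.
  - move=> /le_trans; apply; rewrite -/(D x) /A le_eqVlt; apply/orP; left.
    by apply/eqP; field; rewrite gt_eqF ?powR_gt0.
  - apply: (@le_trans _ _ (\sum_(x <- X) D x `^ b^-1 / K')%R).
      apply: ler_sum => x _; rewrite powRM ?invr_ge0 ?powR_ge0 //.
      rewrite -powRN -powRrM mulNr divff ?gt_eqF // powR_inv1 //; exact: ltW.
    rewrite -mulr_suml ler_pdivrMr // mul1r; apply: le_trans KK'.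
    exact: hK.
have bi0 : (0 < b^-1)%R by rewrite invr_gt0.
have An0 : (0 <= A * n)%R by rewrite mulr_ge0 // ltW.
rewrite -EFinM; case: qy => [->|[t -> [t0 yt]]].
  apply: lpnorm_infty_le => // x.
  have [E [E0 TE EX]] := key [:: x] isT.
  apply: le_trans (TE x (mem_head _ _)) _; rewrite -[leRHS]mulr1 ler_wpM2l //.
  exact: (le1_of_sum_powR_le1 bi0 E0 (mem_head x [::]) EX).
apply: lpnorm_fin_le => // X uX.
have [E [E0 TE EX]] := key X uX.
apply: (@le_trans _ _ (\sum_(x <- X) (A * n) `^ t * E x `^ b^-1)%R); last first.
  by rewrite -mulr_sumr -[leRHS]mulr1 ler_wpM2l ?powR_ge0.
rewrite [leLHS]big_seq [leRHS]big_seq; apply: ler_sum => x xX.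
apply: (@le_trans _ _ ((A * n * E x) `^ t)%R).
  apply: (ge0_ler_powR (ltW t0) _ _ (TE x xX)).
    by rewrite nnegrE normc_ge0.
  by rewrite nnegrE mulr_ge0.
rewrite powRM // ler_wpM2l ?powR_ge0 //.
rewrite powR_le1_anti ?E0 ?(le1_of_sum_powR_le1 bi0 E0 xX EX) //.
by rewrite (ltW bi0) /= invf_ple // -yt.
Qed.
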